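(* Let $\mathbf{X}=\mathbf{X}(\mathbf{x})$ be a smooth vector field on a $2n$-dimensional manifold $M$ with coordinates $\mathbf{x}=(x^1,\dots,x^{2n})$, defining the system $\frac{dx^k}{dt}=X^k$, and let $\omega=\omega_{kl}(\mathbf{x},t)\,dx^k\wedge dx^l$ be a 2-form with phase-space metric $\omega_{kl}(\mathbf{x},t)$ that is skew-symmetric ($\omega_{kl}=-\omega_{lk}$), nondegenerate, and satisfies the Jacobi identity $\partial_k\omega_{lm}+\partial_l\omega_{mk}+\partial_m\omega_{kl}=0$. If the phase-space metric is defined by $$\omega_{kl}(\mathbf{x},t)=\bigl(\exp(t\,\hat J)\bigr)^{ms}_{kl}\,\omega_{ms}(\mathbf{x},0),$$ where $\hat J$ is the operator $$\hat J^{ms}_{kl}=\frac12\Bigl((\delta^m_l\partial_k-\delta^m_k\partial_l)X^s-(\delta^s_l\partial_k-\delta^s_k\partial_l)X^m\Bigr),$$ then $\omega$ is invariant, i.e. an integral of motion of the system: $\frac{d\omega}{dt}=0$.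
   Context: Repeated indices are summed from $1$ to $2n$; $\partial_k=\partial/\partial x^k$; $\delta^m_l$ is the Kronecker delta. $\hat J$ is a first-order differential operator acting on skew-symmetric tensor fields: the derivatives $\partial_k,\partial_l$ act on everything to their right, i.e. on the product of a component of $\mathbf{X}$ with the tensor field. Explicitly, $$(\hat J\omega)_{kl}=\hat J^{ms}_{kl}\omega_{ms}=\tfrac12\bigl[(\delta^m_l\partial_k-\delta^m_k\partial_l)(X^s\omega_{ms})-(\delta^s_l\partial_k-\delta^s_k\partial_l)(X^m\omega_{ms})\bigr].$$ The exponential is the series $\exp(t\hat J)=\sum_{r\ge0}\frac{t^r}{r!}\hat J^r$, understood as a formal power series in $t$; accordingly $\omega_{kl}(\mathbf{x},t)$ is a formal power series in $t$ with smooth coefficients, and the hypotheses and the conclusion are understood as statements about formal power series in $t$ (nondegeneracy means that $\det(\omega_{kl}(\mathbf{x},t))$ is invertible as a formal power series for each $\mathbf{x}$, i.e. $\det(\omega_{kl}(\mathbf{x},0))\neq0$). The total time derivative $d/dt$ of a time-dependent differential form is the derivative along the system: on functions $\frac{df}{dt}=\frac{\partial f}{\partial t}+X^m\partial_mf$, on coordinate differentials $\frac{d}{dt}(dx^k)=dX^k=\partial_mX^k\,dx^m$, extended by the Leibniz rule; equivalently $\frac{d\omega}{dt}=\frac{\partial\omega}{\partial t}+\mathcal{L}_X\omega$ with $\mathcal{L}_X$ the Lie derivative. *)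

(* Defs.v *)
From HB Require Import structures.
From mathcomp Require Import all_boot all_order all_algebra.
From mathcomp Require Import all_classical all_reals all_analysis.

Set Implicit Arguments.
Unset Strict Implicit.
Unset Printing Implicit Defensive.

Import Order.TTheory GRing.Theory Num.Theory.
Import numFieldNormedType.Exports.

Local Open Scope classical_set_scope.
Local Open Scope ring_scope.

(* Formal power series in t: [f r] is the coefficient of t^r in f. *)
Record fps (R : Type) := Fps { fps_coef :> nat -> R }.

Section FpsRing.
Variable R : comNzRingType.
Implicit Types f g h : fps R.

Lemma fpsP f g : (forall r, f r = g r) -> f = g.
Proof.
by case: f => f; case: g => g /= fg; congr Fps; apply/funext.
Qed.

HB.instance Definition _ := gen_eqMixin (fps R).
HB.instance Definition _ := gen_choiceMixin (fps R).

Definition fps_zero : fps R := Fps (fun=> 0).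
Definition fps_opp f : fps R := Fps (fun r => - f r).
Definition fps_add f g : fps R := Fps (fun r => f r + g r).

Fact fps_addA : associative fps_add.
Proof. by move=> f g h; apply: fpsP => r /=; rewrite addrA. Qed.
Fact fps_addC : commutative fps_add.
Proof. by move=> f g; apply: fpsP => r /=; rewrite addrC. Qed.
Fact fps_add0 : left_id fps_zero fps_add.
Proof. by move=> f; apply: fpsP => r /=; rewrite add0r. Qed.
Fact fps_addN : left_inverse fps_zero fps_opp fps_add.
Proof. by move=> f; apply: fpsP => r /=; rewrite addNr. Qed.

HB.instance Definition _ :=
  GRing.isZmodule.Build (fps R) fps_addA fps_addC fps_add0 fps_addN.

Definition fpsC (c : R) : fps R := Fps (fun r => if r == 0%N then c else 0).
Definition fps_mul f g : fps R :=
  Fps (fun r => \sum_(i < r.+1) f i * g (r - i)%N).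

Let trunc N f : {poly R} := \poly_(i < N) f i.

Let coef_trunc N f r : (r < N)%N -> (trunc N f)`_r = f r.
Proof. by move=> rN; rewrite coef_poly rN. Qed.

Let fps_mulE N f g r :
  (r < N)%N -> fps_mul f g r = (trunc N f * trunc N g)`_r.
Proof.
move=> rN; rewrite coefM /=; apply: eq_bigr => i _.
by rewrite !coef_trunc// (leq_ltn_trans _ rN)// ?leq_subr// -ltnS.
Qed.

Fact fps_mulA : associative fps_mul.
Proof.
move=> f g h; apply: fpsP => r.
transitivity ((trunc r.+1 f * (trunc r.+1 g * trunc r.+1 h))`_r).
  rewrite coefM /=; apply: eq_bigr => i _; rewrite coef_trunc//.
  by rewrite -fps_mulE// ltnS leq_subr.
rewrite mulrA coefM /=; apply: eq_bigr => i _.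
by rewrite -fps_mulE// coef_trunc// ltnS leq_subr.
Qed.

Fact fps_mulC : commutative fps_mul.
Proof.
move=> f g; apply: fpsP => r.
by rewrite !(@fps_mulE r.+1)// mulrC.
Qed.

Fact fps_mul1 : left_id (fpsC 1) fps_mul.
Proof.
move=> f; apply: fpsP => r /=; rewrite big_ord_recl /= mul1r subn0.
by rewrite big1 ?addr0// => i _; rewrite mul0r.
Qed.

Fact fps_mulDl : left_distributive fps_mul +%R.
Proof.
move=> f g h; apply: fpsP => r /=; rewrite -big_split /=.
by apply: eq_bigr => i _; rewrite mulrDl.
Qed.

Fact fps_oner_neq0 : fpsC 1 != 0 :> fps R.
Proof.
by apply/eqP => /(congr1 (fun f : fps R => f 0%N)) /eqP; rewrite /= oner_eq0.
Qed.

HB.instance Definition _ := GRing.Zmodule_isComNzRing.Build (fps R)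
  fps_mulA fps_mulC fps_mul1 fps_mulDl fps_oner_neq0.

Definition fps_unit f : bool := `[< exists g, g * f = 1 >].
Definition fps_inv f : fps R :=
  match pselect (exists g, g * f = 1) with
  | left e => projT1 (cid e)
  | right _ => f
  end.

Fact fps_mulVr : {in fps_unit, left_inverse 1 fps_inv *%R}.
Proof.
move=> f /asboolP uf; rewrite /fps_inv; case: pselect => // e.
by case: (cid e).
Qed.

Fact fps_unitP f g : g * f = 1 -> fps_unit f.
Proof. by move=> gf; apply/asboolP; exists g. Qed.

Fact fps_inv_out : {in [predC fps_unit], fps_inv =1 id}.
Proof.
move=> f /asboolP nuf; rewrite /fps_inv.
by case: pselect => // e; case: (nuf e).
Qed.

HB.instance Definition _ := GRing.ComNzRing_hasMulInverse.Build (fps R)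
  fps_mulVr fps_unitP fps_inv_out.

Lemma fpsMCl c f r : (fpsC c * f) r = c * f r.
Proof.
rewrite [LHS]/= big_ord_recl /= subn0 big1 ?addr0// => i _.
by rewrite mul0r.
Qed.

Definition fps_dt f : fps R := Fps (fun r => r.+1%:R * f r.+1).

End FpsRing.

Section PhaseSpace.
Variables (R : realType) (N : nat).
Local Notation pt := 'rV[R]_N.
Implicit Types (U : set pt) (X : pt -> pt) (x : pt).

Definition partial (k : 'I_N) (f : pt -> R) : pt -> R :=
  fun x => 'D_(delta_mx 0 k) f x.

(* f is C^oo on the open set U: all its iterated partial derivatives exist
   and are continuous at every point of U. *)
Definition smooth_on U (f : pt -> R) : Prop :=
  forall (s : seq 'I_N) x, U x ->
    {for x, continuous (foldr partial f s)} /\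
    forall k, derivable (foldr partial f s) x (delta_mx 0 k).

Definition fps_partial (k : 'I_N) (f : pt -> fps R) : pt -> fps R :=
  fun x => Fps (fun r => partial k (fun y => f y r) x).

(* coefficient of t^r of a tensor field depending formally on t *)
Definition tcoef (r : nat) (w : pt -> 'M[fps R]_N) : pt -> 'M[R]_N :=
  fun x => \matrix_(k, l) w x k l r.

Local Notation delta i j := ((i == j)%:R : R).

(* The partial derivatives act on the product of the component of X with
   the component of w. *)
Definition Jhat X (w : pt -> 'M[R]_N) : pt -> 'M[R]_N := fun x =>
  \matrix_(k, l) \sum_m \sum_s 2^-1 *
    ((delta m l * partial k (fun y => X y 0 s * w y m s) x
      - delta m k * partial l (fun y => X y 0 s * w y m s) x)
   - (delta s l * partial k (fun y => X y 0 m * w y m s) x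
      - delta s k * partial l (fun y => X y 0 m * w y m s) x)).

(* exp(t A) w = \sum_r t^r / r! A^r w, as a formal power series in t *)
Definition exp_op (A : (pt -> 'M[R]_N) -> (pt -> 'M[R]_N))
    (w : pt -> 'M[R]_N) : pt -> 'M[fps R]_N := fun x =>
  \matrix_(k, l) Fps (fun r => (r`!)%:R^-1 * iter r A w x k l).

(* Covectors at a point (with coefficients formal power series in t) are the
   rows of their components in the basis dx^k; a 2-form at a point is the
   matrix of its values on pairs of coordinate vectors, with the convention
   (a /\ b)(u, v) = a(u) b(v) - b(u) a(v). *)
Definition dx (k : 'I_N) : 'rV[fps R]_N := delta_mx 0 k.

Definition wedge (a b : 'rV[fps R]_N) : 'M[fps R]_N := a^T *m b - b^T *m a.

(* d/dt along dx^k/dt = X^k, on functions and on the differentials dx^k *)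
Definition ddt_fun X (f : pt -> fps R) : pt -> fps R := fun x =>
  fps_dt (f x) + \sum_m fpsC (X x 0 m) * fps_partial m f x.

Definition ddt_dx X (k : 'I_N) : pt -> 'rV[fps R]_N := fun x =>
  \sum_m fpsC (partial m (fun y => X y 0 k) x) *: dx m.

(* d/dt of w_kl dx^k /\ dx^l, by the Leibniz rule *)
Definition ddt_form2 X (w : pt -> 'M[fps R]_N) : pt -> 'M[fps R]_N := fun x =>
  \sum_k \sum_l
    (ddt_fun X (fun y => w y k l) x *: wedge (dx k) (dx l)
     + w x k l *: (wedge (ddt_dx X k x) (dx l) + wedge (dx k) (ddt_dx X l x))).

End PhaseSpace.

(* Main.v *)
Require Import Defs.
From mathcomp Require Import all_boot all_order all_algebra.
From mathcomp Require Import all_classical all_reals all_analysis.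
From mathcomp Require Import ring.
Import Order.TTheory GRing.Theory Num.Theory.
Import numFieldNormedType.Exports.
Local Open Scope classical_set_scope.
Local Open Scope ring_scope.

Set Implicit Arguments.
Unset Strict Implicit.
Unset Printing Implicit Defensive.

(** The system preserves a form exactly when d omega/dt = 0, that is, when
    the partial t-derivative of omega is minus its Lie derivative along X.

    The operator of the theorem is designed for this.  On a skew-symmetric
    omega its four terms combine in pairs into - d (i_X omega)
    ([Jhat_skew]), and for a closed omega Cartan's formula
    L_X omega = i_X (d omega) + d (i_X omega) turns this into - L_X omega
    ([Jhat_lie2]).  On the other hand exp(t J) solves the evolution equation
    with generator J: its coefficients satisfy
    (r + 1) omega_(r+1) = J omega_r ([exp_op_recursion]).  Comparing the two
    gives (r + 1) omega_(r+1) + L_X omega_r = 0, and the coefficient of t^r in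
    d omega/dt is the antisymmetrization of the left-hand side
    ([coef_ddt_form2]).

    The Jacobi identity and skew-symmetry hold identically in t, hence for
    each omega_r separately, which is what allows the formula J = - L_X to be
    applied to every coefficient.  All hypotheses concern points of the open set U only;
    this is enough because a partial derivative depends only on the germ of
    the function ([eq_partial_on]). *)

(** * Sums with Kronecker deltas *)

Lemma sum_delta (S : pzSemiRingType) (I : finType) (F : I -> S) (c : I) :
  \sum_i (i == c)%:R * F i = F c.
Proof.
rewrite (bigD1 c)//= eqxx mul1r big1 ?addr0// => i /negbTE ->.
by rewrite mul0r.
Qed.

(** The left-hand side is the (a, b) component of
    D_kl dx^k /\ dx^l + W_kl (p^k /\ dx^l + dx^k /\ p^l), the shape that the
    Leibniz rule gives to the derivative of a 2-form; P k lists the components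
    of the covector p^k.  The scalars are abstract so that the deltas are
    eliminated without unfolding power series. *)
Lemma sum_wedge (S : comPzRingType) (I : finType) (D W P : I -> I -> S)
    (a b : I) :
  let A k l := D k l + \sum_m P m k * W m l + \sum_m P m l * W k m in
  \sum_k \sum_l (D k l * ((k == a)%:R * (l == b)%:R
                          - (k == b)%:R * (l == a)%:R)
    + W k l * ((P k a * (l == b)%:R - P k b * (l == a)%:R)
               + ((k == a)%:R * P l b - (k == b)%:R * P l a)))
  = A a b - A b a.
Proof.
move=> A; transitivity (\sum_k \sum_l
    ((k == a)%:R * ((l == b)%:R * D k l)
     + (k == b)%:R * ((l == a)%:R * - D k l)
     + ((l == b)%:R * (P k a * W k l) + (l == a)%:R * - (P k b * W k l))
     + ((k == a)%:R * (P l b * W k l) + (k == b)%:R * - (P l a * W k l)))).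
  by apply: eq_bigr => k _; apply: eq_bigr => l _; ring.
under eq_bigr => k _ do rewrite !big_split -!mulr_sumr !sum_delta.
by rewrite !big_split !sum_delta /= !sumrN /A; ring.
Qed.

(** * Partial derivatives on an open set *)

Section Partial.
Variables (R : realType) (N : nat) (U : set 'rV[R]_N).
Hypothesis openU : open U.
Implicit Types (f g : 'rV[R]_N -> R) (x : 'rV[R]_N) (k : 'I_N).

Lemma eq_partial_on f g k x :
  U x -> (forall y, U y -> f y = g y) -> partial k f x = partial k g x.
Proof.
move=> Ux fg; apply: near_eq_derive.
by near=> y; apply: fg; near: y; exact: open_nbhs_nbhs.
Unshelve. all: by end_near. Qed.

Lemma smooth_derivable f k x :
  smooth_on U f -> U x -> derivable f x (delta_mx 0 k).
Proof. by move=> sf Ux; have [_] := sf [::] x Ux. Qed.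

Lemma partialZ f k x c : derivable f x (delta_mx 0 k) ->
  partial k (fun y => c * f y) x = c * partial k f x.
Proof. exact: deriveZ. Qed.

Lemma partialN f k x : derivable f x (delta_mx 0 k) ->
  partial k (fun y => - f y) x = - partial k f x.
Proof. exact: deriveN. Qed.

Lemma partialM f g k x :
  derivable f x (delta_mx 0 k) -> derivable g x (delta_mx 0 k) ->
  partial k (fun y => f y * g y) x = partial k f x * g x + f x * partial k g x.
Proof.
move=> df dg.
transitivity (f x * partial k g x + g x * partial k f x).
  exact: (deriveM df dg).
by rewrite addrC; congr (_ + _); exact: mulrC.
Qed.

End Partial.

(** * The operator and the Lie derivative *)

Section Operator.
Variables (R : realType) (N : nat) (U : set 'rV[R]_N).
Hypothesis openU : open U.
Variable X : 'rV[R]_N -> 'rV[R]_N.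
Hypothesis smoothX : forall k, smooth_on U (fun x => X x 0 k).
Implicit Types (v w : 'rV[R]_N -> 'M[R]_N) (x : 'rV[R]_N).

Definition smooth_form w := forall k l, smooth_on U (fun x => w x k l).

Definition skew_form w := forall x, U x -> forall k l, w x k l = - w x l k.

Definition closed_form w := forall x, U x -> forall k l m,
  partial k (fun y => w y l m) x + partial l (fun y => w y m k) x
  + partial m (fun y => w y k l) x = 0.

(** The components of L_X w: the transport term, and one term for the action
    of L_X on each of the two differentials. *)
Definition lie2 w x : 'M[R]_N := \matrix_(a, b)
  (\sum_m X x 0 m * partial m (fun y => w y a b) x
   + \sum_m partial a (fun y => X y 0 m) x * w x m b
   + \sum_m partial b (fun y => X y 0 m) x * w x a m).

Let dX k s x : U x -> derivable (fun y => X y 0 s) x (delta_mx 0 k).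
Proof. exact: smooth_derivable. Qed.

Let dW w k a b x : smooth_form w -> U x ->
  derivable (fun y => w y a b) x (delta_mx 0 k).
Proof. by move=> sw; apply: smooth_derivable. Qed.

Let dXW w k s a b x : smooth_form w -> U x ->
  derivable (fun y => X y 0 s * w y a b) x (delta_mx 0 k).
Proof. by move=> sw Ux; apply: derivableM; [exact: dX|exact: dW]. Qed.

Lemma Jhat_entry w x a b : Jhat X w x a b =
  2^-1 * (\sum_s (partial a (fun y => X y 0 s * w y b s) x
                  - partial b (fun y => X y 0 s * w y a s) x)
        - \sum_s (partial a (fun y => X y 0 s * w y s b) x
                  - partial b (fun y => X y 0 s * w y s a) x)).
Proof.
rewrite mxE.
under eq_bigr => m _ do rewrite -mulr_sumr sumrB.
rewrite -mulr_sumr sumrB; congr (_ * (_ - _)).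
  rewrite exchange_big; apply: eq_bigr => s _.
  by rewrite sumrB !sum_delta.
apply: eq_bigr => m _.
by rewrite sumrB !sum_delta.
Qed.

(** Relabelling the skew pair of indices makes the second half of the
    operator equal to the first, which absorbs the factor 1/2: what remains
    are the components of - d (i_X w). *)
Lemma Jhat_skew w x a b : smooth_form w -> skew_form w -> U x ->
  Jhat X w x a b = \sum_s (partial b (fun y => X y 0 s * w y s a) x
                           - partial a (fun y => X y 0 s * w y s b) x).
Proof.
move=> sw kw Ux; rewrite Jhat_entry.
have swap k s c : partial k (fun y => X y 0 s * w y c s) x
    = - partial k (fun y => X y 0 s * w y s c) x.
  rewrite -partialN; last exact: dXW.
  by apply: (eq_partial_on openU) => // y Uy; rewrite kw// mulrN.
under eq_bigr => s _ do rewrite !swap opprK addrC.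
rewrite -[X in _ - X]opprK -sumrN opprK.
under [X in _ + X]eq_bigr => s _ do rewrite opprB.
by field.
Qed.

(** Cartan's formula for closed forms: in L_X w - d (i_X w) the terms with a
    derivative of X cancel, and the terms with a derivative of w are the
    contraction of d w with X. *)
Lemma Jhat_lie2 w x : smooth_form w -> skew_form w -> closed_form w -> U x ->
  Jhat X w x = - lie2 w x.
Proof.
move=> sw kw cw Ux; apply/matrixP => a b; rewrite Jhat_skew// !mxE.
rewrite -!big_split -sumrN; apply: eq_bigr => s _ /=.
rewrite (partialM (@dX b s x Ux) (@dW w b s a x sw Ux)).
rewrite (partialM (@dX a s x Ux) (@dW w a s b x sw Ux)).
have swap : partial a (fun y => w y s b) x = - partial a (fun y => w y b s) x.
  rewrite -partialN; last exact: dW.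
  by apply: (eq_partial_on openU) => // y Uy; rewrite kw.
have -> : partial b (fun y => w y s a) x
    = partial a (fun y => w y s b) x - partial s (fun y => w y a b) x.
  (* The Jacobi identity for the indices s, a, b, added to the right side. *)
  by rewrite swap -[RHS]addr0 -[X in _ = _ + X](cw x Ux s a b); ring.
by rewrite (kw x Ux a s); ring.
Qed.

Lemma Jhat_scale v w c x : smooth_form w -> U x ->
  (forall y, U y -> v y = c *: w y) -> Jhat X v x = c *: Jhat X w x.
Proof.
move=> sw Ux vw.
have scale k s a b : partial k (fun y => X y 0 s * v y a b) x
    = c * partial k (fun y => X y 0 s * w y a b) x.
  rewrite -partialZ; last exact: dXW.
  by apply: (eq_partial_on openU) => // y Uy; rewrite vw// mxE mulrCA.
apply/matrixP => a b; rewrite [RHS]mxE !Jhat_entry [RHS]mulrCA.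
congr (_ * _); rewrite mulrBr !mulr_sumr.
by congr (_ - _); apply: eq_bigr => s _; rewrite !scale mulrBr.
Qed.

End Operator.

(** * The coefficients in t *)

Section Coefficients.
Variables (R : realType) (N : nat).
Variable X : 'rV[R]_N -> 'rV[R]_N.
Implicit Types (w : 'rV[R]_N -> 'M[fps R]_N) (x : 'rV[R]_N).

Lemma fps_coefD (f g : fps R) r : (f + g) r = f r + g r.
Proof. by []. Qed.

Lemma fps_coef_sum (I : finType) (F : I -> fps R) r :
  (\sum_i F i) r = \sum_i F i r.
Proof. by apply: (big_morph (fun f : fps R => f r)). Qed.

Lemma partial_tcoef w k a b r x :
  partial k (fun y => tcoef r w y a b) x = partial k (fun y => w y a b r) x.
Proof. by congr (partial k _ x); apply/funext => y; rewrite mxE. Qed.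

(** The generator passes from the r-th iterate to the r-th coefficient of w
    because these agree up to the constant r! on the whole open set, and not
    only at the point x. *)
Lemma exp_op_recursion (U : set 'rV[R]_N) w r x :
  open U -> (forall k, smooth_on U (fun y => X y 0 k)) ->
  (forall k l, smooth_on U (fun y => w y k l r)) ->
  (forall y, U y -> w y = exp_op (Jhat X) (tcoef 0 w) y) -> U x ->
  r.+1%:R *: tcoef r.+1 w x = Jhat X (tcoef r w) x.
Proof.
move=> oU sX sw wE Ux.
have coefE s y : U y ->
    tcoef s w y = (s`!)%:R^-1 *: iter s (Jhat X) (tcoef 0 w) y.
  by move=> Uy; apply/matrixP => k l; rewrite !mxE {1}wE// mxE.
have fact_neq0 s : (s`!)%:R != 0 :> R by rewrite pnatr_eq0 -lt0n fact_gt0.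
have st : smooth_form U (tcoef r w).
  move=> k l; have -> // : (fun y => tcoef r w y k l) = (fun y => w y k l r).
  by apply/funext => y; rewrite mxE.
have iterE y : U y ->
    iter r (Jhat X) (tcoef 0 w) y = (r`!)%:R *: tcoef r w y.
  by move=> Uy; rewrite coefE// scalerA divff// scale1r.
rewrite coefE//= (Jhat_scale oU sX st Ux iterE) !scalerA.
by rewrite factS natrM invfM -!mulrA mulVf ?mulr1 ?divff ?scale1r//.
Qed.

Lemma wedge_entry (p q : 'rV[fps R]_N) a b :
  wedge p q a b = p 0 a * q 0 b - p 0 b * q 0 a.
Proof. by rewrite !mxE !big_ord1 !mxE (mulrC (q 0 a)). Qed.

Lemma dx_entry (k a : 'I_N) : dx R k 0 a = (k == a)%:R.
Proof. by rewrite mxE eqxx eq_sym. Qed.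

Lemma ddt_dx_entry k x a :
  ddt_dx X k x 0 a = fpsC (partial a (fun y => X y 0 k) x).
Proof.
rewrite summxE -[RHS](sum_delta (fun m => fpsC (partial m _ x)) a).
by apply: eq_bigr => m _; rewrite mxE dx_entry mulrC.
Qed.

Lemma ddt_form2_entry w x a b :
  let A k l := ddt_fun X (fun y => w y k l) x
    + \sum_m ddt_dx X m x 0 k * w x m l + \sum_m ddt_dx X m x 0 l * w x k m in
  ddt_form2 X w x a b = A a b - A b a.
Proof.
have entryE (c d : fps R) (p q p' q' : 'rV[fps R]_N) :
    (c *: wedge p q + d *: (wedge p' q + wedge p q')) a b
    = c * (p 0 a * q 0 b - p 0 b * q 0 a)
      + d * ((p' 0 a * q 0 b - p' 0 b * q 0 a)
             + (p 0 a * q' 0 b - p 0 b * q' 0 a)).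
  by rewrite -!wedge_entry; move: (wedge p q) (wedge p' q) (wedge p q') => *;
    rewrite !mxE.
move=> A; rewrite /A -(sum_wedge (fun k l => ddt_fun X (fun y => w y k l) x)
  (w x) (fun k a => ddt_dx X k x 0 a)).
rewrite summxE; apply: eq_bigr => k _; rewrite summxE; apply: eq_bigr => l _.
by rewrite entryE (dx_entry k a) (dx_entry k b) (dx_entry l a) dx_entry.
Qed.

(** The sum w_kl dx^k /\ dx^l runs over all pairs of indices, so its value on
    a pair of coordinate vectors is w_ab - w_ba; the same antisymmetrization
    acts on the derivative.  The first summand of E is the contribution of the
    partial t-derivative. *)
Lemma coef_ddt_form2 w x r :
  let E := r.+1%:R *: tcoef r.+1 w x + lie2 X (tcoef r w) x in
  tcoef r (ddt_form2 X w) x = E - E^T.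
Proof.
set S := fun a b : 'I_N => (ddt_fun X (fun y => w y a b) x
    + \sum_m ddt_dx X m x 0 a * w x m b
    + \sum_m ddt_dx X m x 0 b * w x a m) r.
move=> E; have SE a b : S a b = E a b.
  rewrite /S /E !fps_coefD !fps_coef_sum !mxE -!addrA; congr (_ + (_ + (_ + _))).
  - by apply: eq_bigr => m _; rewrite fpsMCl partial_tcoef.
  - by apply: eq_bigr => m _; rewrite ddt_dx_entry fpsMCl mxE.
  - by apply: eq_bigr => m _; rewrite ddt_dx_entry fpsMCl mxE.
apply/matrixP => a b; rewrite mxE ddt_form2_entry [RHS]mxE.
by rewrite [X in _ = _ + X]mxE [X in _ = _ - X]mxE -!SE.
Qed.

End Coefficients.

Theorem proposition4 (R : realType) (n : nat)
    (U : set 'rV[R]_(2 * n)) (X : 'rV[R]_(2 * n) -> 'rV[R]_(2 * n))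
    (w : 'rV[R]_(2 * n) -> 'M[fps R]_(2 * n)) :
  open U ->
  (forall k, smooth_on U (fun x => X x 0 k)) ->
  (forall k l r, smooth_on U (fun x => w x k l r)) ->
  (forall x, U x -> forall k l, w x k l = - w x l k) ->
  (forall x, U x -> \det (w x) \is a GRing.unit) ->
  (forall x, U x -> forall k l m,
     fps_partial k (fun y => w y l m) x + fps_partial l (fun y => w y m k) x
     + fps_partial m (fun y => w y k l) x = 0) ->
  (forall x, U x -> w x = exp_op (Jhat X) (tcoef 0 w) x) ->
  forall x, U x -> ddt_form2 X w x = 0.
Proof.
move=> oU sX sw kw _ cw wE x Ux.
suff coef0 r : tcoef r (ddt_form2 X w) x = 0.
  apply/matrixP => a b; apply: fpsP => r.
  by have /matrixP/(_ a b) := coef0 r; rewrite !mxE.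
have st : smooth_form U (tcoef r w).
  move=> k l; rewrite (_ : (fun y => _) = fun y => w y k l r)//.
  by apply/funext => y; rewrite mxE.
have kt : skew_form U (tcoef r w).
  by move=> y Uy k l; rewrite !mxE kw.
have ct : closed_form U (tcoef r w).
  move=> y Uy k l m; rewrite !partial_tcoef.
  exact: (congr1 (fun f : fps R => f r) (cw y Uy k l m)).
rewrite coef_ddt_form2 (exp_op_recursion oU sX (fun k l => sw k l r) wE Ux).
by rewrite (Jhat_lie2 oU sX st kt ct Ux) addNr trmx0 subr0.
Qed.
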